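(* Let $a\ge2$ and $0\le b<a$ be integers, and run the golden sieve on $W_0=a\mathbb{N}+b$. Then the limit $\lim_{n\to\infty}\sigma_n/n$ exists and is the unique real number $\alpha=\alpha(a)\in(1,2)$ satisfying $$\alpha=1+\frac{1}{a\alpha}\quad\Longleftrightarrow\quad a\alpha^2-a\alpha-1=0.$$ Equivalently, $$\alpha(a)=\frac{1+\sqrt{1+4/a}}{2}=\frac{a+\sqrt{a^2+4a}}{2a}.$$ Moreover, $$\lim_{n\to\infty}\frac{\delta_n}{n}=a\,\alpha(a)+1.$$
   Context: $\mathbb{N}=\{1,2,3,\ldots\}$ and $a\mathbb{N}+b=\{an+b:n\ge1\}$, viewed as an increasing sequence. For a strictly increasing sequence $X$ of positive integers, $X(k)$ denotes its $k$-th term. Golden sieve: let $W_0=(w_1<w_2<\cdots)$ be an infinite strictly increasing sequence of positive integers. For $n\ge1$ define inductively $h_n:=W_{n-1}(n)$ (the pointer), $d_n:=W_{n-1}(h_n)$ (the deletion), and let $W_n$ be the increasing sequence obtained from $W_{n-1}$ by removing the value $d_n$. The survivor sequence $(s_n)_{n\ge1}$ is the increasing enumeration of $W_0\setminus\{d_1,d_2,\ldots\}$. Normalization for $W_0=a\mathbb{N}+b$: $\sigma_n:=(s_n-b)/a$ and $\delta_n:=(d_n-b)/a$. *)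

(* Defs.v *)
From mathcomp Require Import all_boot all_order all_algebra.
From mathcomp Require Import all_classical all_reals all_analysis.

Set Implicit Arguments.
Unset Strict Implicit.
Unset Printing Implicit Defensive.

Import Order.TTheory GRing.Theory Num.Theory.
Import numFieldNormedType.Exports.

Local Open Scope classical_set_scope.

(* A sequence X of positive integers is a function nat -> nat whose k-th term,
   counting from k = 1, is X k; the value X 0 carries no meaning. *)

Definition terms (X : nat -> nat) : set nat := X @` [set k | 0 < k].

(* When X is strictly increasing and d is one of its terms, this is the
   increasing sequence of the remaining terms: those below d keep their
   position and those above d move down by one. *)
Definition remove_value (X : nat -> nat) (d : nat) : nat -> nat :=
  fun k => if X k < d then X k else X k.+1.

(* The n-th smallest element of A (n >= 1): the v in A such that exactly n
   elements of A are at most v; it is 0 if A has fewer than n elements. *)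
Definition increasing_enum (A : set nat) (n : nat) : nat :=
  xget 0 [set v | A v /\ count (mem A) (iota 0 v.+1) = n].

Fixpoint golden_sieve (W0 : nat -> nat) (n : nat) : nat -> nat :=
  if n is m.+1 then
    let W := golden_sieve W0 m in remove_value W (W (W m.+1))
  else W0.

Definition pointer (W0 : nat -> nat) (n : nat) : nat :=
  golden_sieve W0 n.-1 n.

Definition deletion (W0 : nat -> nat) (n : nat) : nat :=
  golden_sieve W0 n.-1 (pointer W0 n).

Definition survivor (W0 : nat -> nat) : nat -> nat :=
  increasing_enum (terms W0 `\` terms (deletion W0)).

Definition arith_seq (a b : nat) : nat -> nat := fun n => a * n + b.

Local Open Scope ring_scope.

Definition sigma (R : realType) (a b n : nat) : R :=
  ((survivor (arith_seq a b) n)%:R - b%:R) / a%:R.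

Definition delta (R : realType) (a b n : nat) : R :=
  ((deletion (arith_seq a b) n)%:R - b%:R) / a%:R.

(* Main.v *)
(** Every deletion happens strictly beyond the pointer, so the n-th survivor is
    the n-th pointer [s n] and the n-th deleted value occupies position
    [s n + n - 1] of [W0]. Hence the position of [s n] in [W0] is [n + c], where
    [c] is the number of [j] with [s j <= n]. For [W0 = a N + b] this reads
    [s n = a (n + c) + b] with [s c <= n < s (c + 1)], a self-referential
    relation that contracts deviations from the line [a alpha n] by the factor
    [1 / alpha]; they are therefore bounded, and both limits follow. *)

Require Import Defs.
From mathcomp Require Import all_boot all_order all_algebra.
From mathcomp Require Import all_classical all_reals all_analysis.
From mathcomp Require Import zify ring lra.

Set Implicit Arguments.
Unset Strict Implicit.
Unset Printing Implicit Defensive.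

Import Order.TTheory GRing.Theory Num.Theory.
Import numFieldNormedType.Exports.

Local Open Scope classical_set_scope.

(** * Strictly increasing sequences and their enumeration *)

Definition strictly_increasing (X : nat -> nat) := {mono X : m n / m < n}.

Lemma homo_strictly_increasing (X : nat -> nat) :
  (forall k, X k < X k.+1) -> strictly_increasing X.
Proof.
move=> XS; apply: leqW_mono; apply: leq_mono.
exact: (homo_ltn ltn_trans XS).
Qed.

Lemma strictly_increasing_le (X : nat -> nat) :
  strictly_increasing X -> {mono X : m n / m <= n}.
Proof. by move=> Xmono m n; rewrite leqNgt Xmono -leqNgt. Qed.

Lemma strictly_increasing_inj (X : nat -> nat) :
  strictly_increasing X -> injective X.
Proof.
move=> /strictly_increasing_le Xle m n XE.
by apply/eqP; rewrite eqn_leq -Xle -[n <= m]Xle XE leqnn.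
Qed.

Lemma remove_value_index (X : nat -> nat) i k : strictly_increasing X ->
  remove_value X (X i) k = if k < i then X k else X k.+1.
Proof. by move=> Xmono; rewrite /remove_value Xmono. Qed.

Lemma strictly_increasing_remove_value (X : nat -> nat) i :
  strictly_increasing X -> strictly_increasing (remove_value X (X i)).
Proof.
move=> Xmono; apply: homo_strictly_increasing => k.
rewrite !remove_value_index //.
by case: ifP; case: ifP; rewrite Xmono; lia.
Qed.

(** The elements of [A] up to [s k] are exactly [s 1], ..., [s k], so the count defining
    [increasing_enum] recovers the index. *)
Lemma increasing_enum_eq (A : set nat) (s : nat -> nat) n :
  strictly_increasing s -> (forall v, A v <-> exists2 k, 0 < k & s k = v) ->
  0 < n -> increasing_enum A n = s n.
Proof.
move=> smono As n0.
have cnt k : count (mem A) (iota 0 (s k).+1) = k.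
  rewrite -size_filter -[RHS](size_iota 1) -[RHS](size_map s); apply: perm_size.
  apply: uniq_perm; first by rewrite filter_uniq ?iota_uniq.
    by rewrite map_inj_uniq ?iota_uniq //; exact: strictly_increasing_inj.
  move=> v; rewrite mem_filter mem_iota add0n /=.
  apply/andP/mapP => [[/set_mem /As [j j0 <-]]|[j]].
    rewrite ltnS strictly_increasing_le // => jk.
    by exists j; rewrite // mem_iota; lia.
  rewrite mem_iota => jk ->; rewrite ltnS strictly_increasing_le //.
  split; last lia.
  by apply/mem_set/As; exists j => //; lia.
rewrite /increasing_enum; apply: xget_unique.
  by split; [apply/As; exists n|exact: cnt].
by move=> _ [/As [k _ <-]]; rewrite cnt => ->.
Qed.

(** * The sieve on a general sequence lying above the identity *)

Section GoldenSieve.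

Variable W0 : nat -> nat.
Hypothesis W0_mono : strictly_increasing W0.
Hypothesis W0_gt_id : forall k, 0 < k -> k < W0 k.

Local Notation W := (golden_sieve W0).

Definition diag_sieve n := W n n.
Local Notation s := diag_sieve.

Lemma golden_sieve_mono n : strictly_increasing (W n).
Proof. by elim: n => //= n IHn; exact: strictly_increasing_remove_value. Qed.

Lemma golden_sieveS n k :
  W n.+1 k = if k < W n n.+1 then W n k else W n k.+1.
Proof. exact: remove_value_index (golden_sieve_mono n). Qed.

Lemma golden_sieve_gt_id n k : 0 < k -> k < W n k.
Proof.
move=> k0; elim: n => [|n IHn]; first exact: W0_gt_id.
rewrite golden_sieveS; case: ifP => // _.
by apply: ltn_trans IHn _; rewrite golden_sieve_mono.
Qed.

(** Deletion [n.+1] hits the index [W n n.+1], which exceeds [n.+1], so the pointed term stays in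
    place. *)
Lemma diag_sieveS n : s n.+1 = W n n.+1.
Proof. by rewrite /s golden_sieveS golden_sieve_gt_id. Qed.

Lemma pointerE n : 0 < n -> pointer W0 n = s n.
Proof. by case: n => // n _; rewrite diag_sieveS. Qed.

Lemma diag_sieve_mono : strictly_increasing s.
Proof.
by apply: homo_strictly_increasing => n; rewrite diag_sieveS golden_sieve_mono.
Qed.

Lemma diag_sieve_gt_id n : 0 < n -> n < s n.
Proof. exact: golden_sieve_gt_id. Qed.

Lemma golden_sieve_stable m n : n <= m -> W m n = s n.
Proof.
elim: m => [|m IHm]; first by rewrite leqn0 => /eqP->.
rewrite leq_eqVlt => /predU1P[->//|nm].
rewrite golden_sieveS IHm //.
suff -> : n < W m m.+1 by [].
by rewrite (ltn_trans nm) // golden_sieve_gt_id.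
Qed.

(** The first [n] deletions hit the indices [s 1 < ... < s n], so each one moves every index from
    [s n] on by one. *)
Lemma golden_sieve_shift n k : s n <= k -> W n k = W0 (k + n).
Proof.
elim: n k => [|n IHn] k; first by rewrite addn0.
move=> snk; rewrite golden_sieveS -diag_sieveS ltnNge snk /= IHn ?addnS //.
by apply: leq_trans (leqW snk); rewrite strictly_increasing_le //;
  exact: diag_sieve_mono.
Qed.

Lemma deletionE n : deletion W0 n.+1 = W0 (s n.+1 + n).
Proof.
rewrite /deletion pointerE // golden_sieve_shift //.
by rewrite strictly_increasing_le //; exact: diag_sieve_mono.
Qed.

(* The witness [c] counts the deletions that took place at or below [k]. *)
Lemma golden_sieve_position n k : exists c, [/\ c <= n, W n k = W0 (k + c) &
  forall j, 0 < j <= n -> (s j <= k) = (j <= c)].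
Proof.
elim: n => [|n [c [cn Wc sc]]].
  by exists 0; split; rewrite ?addn0 // => j; lia.
(* From index [s n.+1] on, all [n.+1] deletions count; below it the new deletion changes neither the
   term nor [c]. *)
have [skn|kns] := leqP (s n.+1) k.
  exists n.+1; split=> //; first exact: golden_sieve_shift.
  move=> j /andP[_ jn]; rewrite jn; apply: leq_trans skn.
  by rewrite strictly_increasing_le //; exact: diag_sieve_mono.
exists c; split; first exact: leqW.
  by rewrite golden_sieveS -diag_sieveS kns.
move=> j /andP[j0]; rewrite leq_eqVlt => /predU1P[->|jn].
  by rewrite leqNgt kns /= ltnNge cn.
by rewrite sc // j0.
Qed.

Lemma diag_sieve_position n : exists c, [/\ s n = W0 (n + c),
  0 < c -> s c <= n & n < s c.+1].
Proof.
have [c [cn Wc sc]] := golden_sieve_position n n; exists c; split=> //.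
  by move=> c0; rewrite sc ?c0 ?leqnn.
(* [sc] only covers indices up to [n]; for [c = n] the bound comes from [n.+1 < s n.+1]. *)
have [->|cn'] := eqVneq c n.
  by apply: ltn_trans (diag_sieve_gt_id _).
by rewrite ltnNge sc ?ltnn //; lia.
Qed.

(** A deleted value never returns, since each stage takes its values from the previous one;
    stability makes [s n] a value of a stage after deletion [j]. *)
Lemma diag_sieve_neq_deletion n j : 0 < j -> s n != deletion W0 j.
Proof.
case: j => // j _.
have Wd m k : j < m -> W m k != deletion W0 j.+1.
  elim: m k => // m IHm k; rewrite ltnS leq_eqVlt => /predU1P[<-|jm].
    rewrite golden_sieveS /deletion /pointer /=.
    by case: ifP => kh;
      rewrite (inj_eq (strictly_increasing_inj (golden_sieve_mono _))); lia.
  by rewrite golden_sieveS; case: ifP => _; exact: IHm.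
rewrite -(@golden_sieve_stable (maxn n j.+1)) ?leq_maxl //.
by apply: Wd; rewrite leq_maxr.
Qed.

Lemma terms_golden_sieve v m : (terms W0 `\` terms (deletion W0)) v ->
  terms (W m) v.
Proof.
move=> [W0v ndel]; elim: m => [//|m [k k0 Wk]].
have [kh|hk|hk] := ltngtP k (W m m.+1).
- by exists k => //; rewrite golden_sieveS kh.
(* The index drops by one and stays positive, because the deleted index is itself positive. *)
- case: k k0 hk Wk => // k _ hk Wk; exists k.
    by rewrite /=; have := golden_sieve_gt_id m (ltn0Sn m); lia.
  by rewrite golden_sieveS ltnNge -ltnS hk.
- by case: ndel; exists m.+1; rewrite // -Wk hk.
Qed.

Lemma survivorE n : 0 < n -> survivor W0 n = s n.
Proof.
apply: increasing_enum_eq => [|v]; first exact: diag_sieve_mono.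
(* Stage [v] is late enough: [v = W v k] gives [k < v], so this term is already final and equals
   [s k]. *)
split=> [/(@terms_golden_sieve v v) [k /= k0 Wk]|[k k0 <-]].
  exists k => //; rewrite -(@golden_sieve_stable v) // -[leqRHS]Wk.
  exact/ltnW/golden_sieve_gt_id.
split=> [|[j /= j0 /eqP]].
  have [c [sk _ _]] := diag_sieve_position k.
  by exists (k + c); rewrite //= addn_gt0 k0.
by rewrite eq_sym (negbTE (diag_sieve_neq_deletion _ _)).
Qed.

End GoldenSieve.

Local Open Scope ring_scope.

Lemma cvg_div_nat (R : realType) (u : nat -> R) (l C : R) :
  (forall n, (0 < n)%N -> `|u n - l * n%:R| <= C) ->
  (fun n => u n / n%:R) @ \oo --> l.
Proof.
move=> uC; apply/cvgrPdist_le => e e0.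
near=> n.
have n0 : 0 < n%:R :> R by rewrite ltr0n; near: n; exists 1%N.
rewrite distrC (_ : u n / n%:R - l = (u n - l * n%:R) / n%:R); last first.
  by field; rewrite gt_eqF.
rewrite normrM normfV (gtr0_norm n0) ler_pdivrMr //.
apply: (le_trans (uC _ _)); first by rewrite -(ltr0n R).
rewrite -ler_pdivrMl // mulrC; near: n; exact: nbhs_infty_ger.
Unshelve. all: by end_near. Qed.

Lemma arith_seq_mono a b : (0 < a)%N -> strictly_increasing (arith_seq a b).
Proof. by move=> a0 m n; rewrite /arith_seq ltn_add2r ltn_pmul2l. Qed.

Lemma arith_seq_gt_id a b k : (1 < a)%N -> (0 < k)%N -> (k < arith_seq a b k)%N.
Proof. by rewrite /arith_seq; nia. Qed.

(** * Linear growth over an arithmetic progression *)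

Section GoldenSieveArith.

Variables a b : nat.
Hypotheses (a_ge2 : (2 <= a)%N) (b_lt_a : (b < a)%N).

Let s := diag_sieve (arith_seq a b).

Let W0_mono : strictly_increasing (arith_seq a b) :=
  arith_seq_mono b (ltnW a_ge2).

Let W0_gt_id k : (0 < k)%N -> (k < arith_seq a b k)%N :=
  arith_seq_gt_id b a_ge2.

Let s_mono : strictly_increasing s := diag_sieve_mono W0_mono W0_gt_id.

Let s_le := strictly_increasing_le s_mono.

Let s_gt_id n : (0 < n)%N -> (n < s n)%N :=
  diag_sieve_gt_id W0_mono W0_gt_id (n := n).

Lemma diag_sieve_arith n : exists c, [/\ s n = (a * (n + c) + b)%N,
  (0 < c -> s c <= n)%N & (n < s c.+1)%N].
Proof. exact: diag_sieve_position W0_mono W0_gt_id n. Qed.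

(** The gap is [a * (1 + c' - c)], and [c' >= c + 2] would force [s c.+1 < s c.+2 <= n.+1], against
    [n < s c.+1]. *)
Lemma diag_sieve_gap n : (s n.+1 <= s n + 2 * a)%N.
Proof.
have [c [-> _ nc]] := diag_sieve_arith n.
have [c' [-> c'n _]] := diag_sieve_arith n.+1.
have [|c'c] := leqP c' c.+1; first nia.
have : (s c.+2 <= n.+1)%N by apply: leq_trans (c'n _); rewrite ?s_le //; lia.
have : (s c.+1 < s c.+2)%N by rewrite s_mono.
lia.
Qed.

(* The deviations [e n := s n - a * alpha * n] satisfy
   [e n = - e c / alpha + O(1)] for some [c < n], and [alpha > 1]. *)
Lemma diag_sieve_linear (R : realType) (alpha : R) : 1 < alpha ->
  a%:R * alpha ^+ 2 = a%:R * alpha + 1 ->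
  exists C : R, forall n, `|(s n)%:R - a%:R * alpha * n%:R| <= C.
Proof.
move=> alpha_gt1 alphaE; have a0 : 0 < a%:R :> R by rewrite ltr0n; lia.
have al1 : 0 < alpha - 1 by rewrite subr_gt0.
have ba : b%:R <= a%:R :> R by rewrite ler_nat ltnW.
have b0 : 0 <= b%:R :> R by [].
(* [C] is the fixed point of the recursive bound [C * alpha = C + 3 * a * alpha], whose last term
   absorbs the bounded errors. *)
exists (3 * a%:R * alpha / (alpha - 1)); set C := _ / _.
have CE : C * alpha = C + 3 * a%:R * alpha.
  by rewrite /C; field; rewrite gt_eqF.
elim/ltn_ind => n IHn.
have s0 : s 0 = b by rewrite /s /diag_sieve /= /arith_seq muln0.
have [->|n0] := posnP n.
  rewrite s0 mulr0 subr0 ger0_norm // -(ler_pM2r al1) /C divfK ?gt_eqF //; nra.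
have [c [snE sc nsc]] := diag_sieve_arith n.
have cn : (c < n)%N.
  by case: c sc {snE nsc} => // c /(_ isT); apply: leq_trans; exact: s_gt_id.
have gap := diag_sieve_gap c.
(* The slack [b] covers [c = 0], where [s 0 = b] may exceed [n]. *)
have {}sc : (s c <= n + b)%N.
  by case: posnP sc => [->|c0 /(_ isT)]; rewrite ?s0; lia.
have sc_lo : (s c)%:R <= n%:R + b%:R :> R by rewrite -natrD ler_nat.
have sc_hi : n%:R <= (s c)%:R + 2 * a%:R :> R.
  by rewrite -natrM -natrD ler_nat; lia.
have := IHn c cn; rewrite snE natrD natrM natrD.
set x := (s c)%:R in sc_lo sc_hi *; rewrite !ler_norml.
move=> /andP[lo hi].
have al0 : 0 < alpha by apply: lt_trans alpha_gt1.
(* Multiplying by [alpha] and using the quadratic equation turns the deviation at [n] into minus the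
   one at [c], up to [b * alpha] and [n - s c]. *)
have eE : (a%:R * (n%:R + c%:R) + b%:R - a%:R * alpha * n%:R) * alpha
  = b%:R * alpha - (x - a%:R * alpha * c%:R) - (n%:R - x).
  by ring: alphaE.
have bal : b%:R * alpha <= a%:R * alpha by rewrite ler_pM2r.
have aal : a%:R <= a%:R * alpha by rewrite ler_peMr // ltW.
have bal0 : 0 <= b%:R * alpha by rewrite mulr_ge0 // ltW.
by apply/andP; split; rewrite -(ler_pM2r al0) eE ?mulNr CE; lra.
Qed.

End GoldenSieveArith.

(** * The quadratic equation, closed forms and limits *)

Lemma sqrt_golden (R : realType) (a : nat) : (0 < a)%N ->
  Num.sqrt (a%:R ^+ 2 + 4 * a%:R) = a%:R * Num.sqrt (1 + 4 / a%:R) :> R.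
Proof.
move=> a0; have aR0 : 0 < a%:R :> R by rewrite ltr0n.
have -> : a%:R ^+ 2 + 4 * a%:R = a%:R ^+ 2 * (1 + 4 / a%:R) :> R.
  by field; rewrite gt_eqF.
by rewrite sqrtrM ?sqr_ge0 // sqrtr_sqr gtr0_norm.
Qed.

Lemma golden_equation (R : realType) (a : nat) (x : R) : (0 < a)%N -> x != 0 ->
  x = 1 + 1 / (a%:R * x) <-> a%:R * x ^+ 2 - a%:R * x - 1 = 0.
Proof.
move=> a0 x0; have aR0 : a%:R != 0 :> R by rewrite pnatr_eq0 -lt0n.
have -> : a%:R * x ^+ 2 - a%:R * x - 1 = a%:R * x * (x - (1 + 1 / (a%:R * x))).
  by field; rewrite aR0 x0.
split=> [<-|/eqP]; first by rewrite subrr mulr0.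
by rewrite !mulf_eq0 (negbTE aR0) (negbTE x0) subr_eq0 /= => /eqP.
Qed.

Theorem theorem4p6 (R : realType) (a b : nat) (ha : (2 <= a)%N)
    (hb : (b < a)%N) :
  (forall x : R, x != 0 ->
     (x = 1 + 1 / (a%:R * x) <-> a%:R * x ^+ 2 - a%:R * x - 1 = 0)) /\
  exists alpha : R,
    [/\ unique (fun x : R => 1 < x < 2 /\ x = 1 + 1 / (a%:R * x)) alpha,
        alpha = (1 + Num.sqrt (1 + 4 / a%:R)) / 2,
        alpha = (a%:R + Num.sqrt (a%:R ^+ 2 + 4 * a%:R)) / (2 * a%:R),
        (fun n : nat => sigma R a b n / n%:R) @ \oo --> alpha &
        (fun n : nat => delta R a b n / n%:R) @ \oo --> a%:R * alpha + 1].
Proof.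
have a0 : (0 < a)%N by exact: ltnW.
have aR0 : 0 < a%:R :> R by rewrite ltr0n.
have aR2 : 2 <= a%:R :> R by rewrite ler_nat.
split=> [x|]; first exact: golden_equation.
set r := Num.sqrt (1 + 4 / a%:R); set alpha := (1 + r) / 2.
have r2 : a%:R * r ^+ 2 = a%:R + 4.
  rewrite sqr_sqrtr; first by field; rewrite gt_eqF.
  by rewrite addr_ge0 // divr_ge0.
have r0 : 0 <= r := sqrtr_ge0 _.
have r_gt1 : 1 < r.
  have : 1 < r ^+ 2 by rewrite -(ltr_pM2l aR0) r2; lra.
  by nra.
(* Here [a >= 2] enters: [r ^+ 2 = 1 + 4 / a] is at most 3. *)
have r_lt3 : r < 3.
  have : r ^+ 2 <= 3 by rewrite -(ler_pM2l aR0) r2; lra.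
  by nra.
have alpha_gt1 : 1 < alpha by rewrite /alpha; lra.
have alpha_lt2 : alpha < 2 by rewrite /alpha; lra.
have alphaE : a%:R * alpha ^+ 2 = a%:R * alpha + 1.
  by rewrite /alpha; field: r2.
have [C sC] := diag_sieve_linear ha hb alpha_gt1 alphaE.
have W0_mono := arith_seq_mono b a0.
have W0_gt_id k := @arith_seq_gt_id a b k ha.
exists alpha; split=> //.
- split=> [|x [/andP[x1 x2] /golden_equation]].
    split; first by rewrite alpha_gt1.
    apply/golden_equation => //; last lra.
    by rewrite gt_eqF // (lt_trans _ alpha_gt1).
  rewrite gt_eqF ?(lt_trans _ x1) // => /(_ a0 isT) xE.
  have {}xE : a%:R * x ^+ 2 = a%:R * x + 1 by lra.
  (* This is the difference of the two quadratic equations; [alpha + x - 1] is positive as both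
     roots exceed 1. *)
  have /eqP : a%:R * ((alpha - x) * (alpha + x - 1)) = 0 by nra.
  rewrite !mulf_eq0 gt_eqF //= subr_eq0 => /orP[/eqP //|/eqP]; lra.
- by rewrite sqrt_golden // -/r /alpha; field; rewrite gt_eqF.
- apply: (@cvg_div_nat _ _ _ ((C + b%:R) / a%:R)) => n n0.
  rewrite /sigma survivorE // ler_pdivlMr //.
  rewrite -[X in _ * X](gtr0_norm aR0) -normrM.
  rewrite (_ : _ * _ = ((diag_sieve (arith_seq a b) n)%:R - a%:R * alpha * n%:R)
    - b%:R); last by field; rewrite gt_eqF.
  by rewrite (le_trans (ler_normB _ _)) // lerD // normr_nat.
(* The normalized deletion is [s n.+1 + n], so its deviation is that of [s n.+1] minus 1. *)
- apply: (@cvg_div_nat _ _ _ (C + 1)) => -[//|n] _.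
  rewrite /delta deletionE // /arith_seq.
  rewrite (_ : _ - _ = ((diag_sieve (arith_seq a b) n.+1)%:R
    - a%:R * alpha * n.+1%:R) - 1).
    by rewrite (le_trans (ler_normB _ _)) // lerD // normr1.
  by rewrite natrD natrM natrD -natr1; field; rewrite gt_eqF.
Qed.
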